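(* Let $n,d\in\mathbb{N}$ with $d\mid n$, let $\chi$ be a Dirichlet character (mod $n$) with conductor $d$, and let $s\in\mathbb{Z}$. Then $$\sum_{k=1}^n c_n(k-s)\,\chi(k)=d\,\varphi(n)\,\chi^*(s)\sum_{\substack{\delta\mid n/d\\ (\delta,s)=1}}\frac{\delta\,\mu(n/(\delta d))}{\varphi(\delta d)},$$ where $\chi^*$ is the primitive character (mod $d$) that induces $\chi$.
   Context: $\mathbb{N}$ is the set of positive integers. $(a,b)$ denotes the greatest common divisor (nonnegative, with $(0,n)=n$ for $n\in\mathbb{N}$). $\varphi$ is Euler's totient function and $\mu$ is the Möbius function. $c_n(k)$ is the Ramanujan sum, $c_n(k)=\sum_{1\le j\le n,\ (j,n)=1}e^{2\pi i jk/n}$ for $k\in\mathbb{Z}$. The primitive character $\chi^*$ (mod $d$) inducing $\chi$ is the unique primitive Dirichlet character (mod $d$) such that $\chi(k)=\chi^*(k)$ if $(k,n)=1$ and $\chi(k)=0$ if $(k,n)>1$. Sums over $\delta\mid n/d$ are over positive divisors. *)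

(* Defs.v *)
From mathcomp Require Import all_boot all_order all_algebra.
From mathcomp Require Import reals trigo complex.

Set Implicit Arguments.
Unset Strict Implicit.
Unset Printing Implicit Defensive.

Import Order.TTheory GRing.Theory Num.Theory.
Local Open Scope ring_scope.
Local Open Scope complex_scope.

Definition expi (R : realType) (t : R) : R[i] := cos t +i* sin t.

Definition ramanujan_sum (R : realType) (n : nat) (k : int) : R[i] :=
  \sum_(1 <= j < n.+1 | coprime j n)
    expi (2 * pi * (j%:Z * k)%:~R / n%:R : R).

Definition moebius (n : nat) : int :=
  if (0 < n)%N && all (fun p => ~~ (p ^ 2 %| n)%N) (primes n)
  then (-1) ^+ size (primes n) else 0.

(* The last clause rules out the zero function and forces chi 1 = 1. *)
Definition dirichlet_character (R : realType) (n : nat) (chi : int -> R[i]) :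
    Prop :=
  [/\ forall a b : int, (a = b %[mod n])%Z -> chi a = chi b,
      forall a b : int, chi (a * b) = chi a * chi b
    & forall a : int, chi a != 0 <-> coprimez a n].

Definition induced_modulus (R : realType) (n : nat) (chi : int -> R[i])
    (d : nat) : Prop :=
  (d %| n)%N /\
  forall a : int, coprimez a n -> (a = 1 %[mod d])%Z -> chi a = 1.

(* The conductor of chi (mod n) is its least induced modulus. *)
Definition conductor (R : realType) (n : nat) (chi : int -> R[i])
    (d : nat) : Prop :=
  induced_modulus n chi d /\
  forall e : nat, induced_modulus n chi e -> (d <= e)%N.

Definition primitive_character (R : realType) (n : nat) (chi : int -> R[i]) :
    Prop :=
  dirichlet_character n chi /\ conductor n chi n.

(* [induces d n chis chi]: chis is the primitive character (mod d) inducing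
   the character chi (mod n). *)
Definition induces (R : realType) (d n : nat) (chis chi : int -> R[i]) :
    Prop :=
  primitive_character d chis /\
  forall k : int, chi k = if coprimez k n then chis k else 0.

(* Main.v *)
(** Expanding the Ramanujan sum as [c_n(m) = \sum_(e | gcd(n, m)) e mu(n/e)]
    turns the left-hand side into [\sum_(e | n) e mu(n/e) T(e)], where [T(e)] is
    the sum of [chi] over the residues mod [n] congruent to [s] mod [e].
    Multiplying those residues by a unit [a = 1] mod [e] shows
    [T(e) = chi a * T(e)], so [T(e) <> 0] makes [e] an induced modulus.  Induced
    moduli are closed under gcd, hence the conductor [d] then divides [e].  When
    [d | e], every nonzero term of [T(e)] equals [chis s], and the units mod [n]
    are equidistributed over those mod [e], so [T(e) = chis s phi(n)/phi(e)] if
    [s] is prime to [e], and [0] otherwise.  Put [e = d delta]. *)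
Require Import Defs.
From mathcomp Require Import all_boot all_order all_algebra.
From mathcomp Require Import reals trigo complex.
From mathcomp Require Import ring lra.

Set Implicit Arguments.
Unset Strict Implicit.
Unset Printing Implicit Defensive.

Import Order.TTheory GRing.Theory Num.Theory.
Local Open Scope ring_scope.
Local Open Scope complex_scope.

(** * Divisor sums and the Möbius function *)

Lemma perm_divisors_dvd (d n : nat) : (0 < n)%N -> (d %| n)%N ->
  perm_eq [seq e <- divisors n | (d %| e)%N]
          [seq (d * e)%N | e <- divisors (n %/ d)].
Proof.
move=> n0 dn; have d0 := dvdn_gt0 n0 dn.
have nd0 : (0 < n %/ d)%N by rewrite divn_gt0 // dvdn_leq.
apply: uniq_perm.
- exact: filter_uniq (divisors_uniq n).
- rewrite map_inj_uniq ?divisors_uniq // => x y /eqP.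
  by rewrite eqn_pmul2l // => /eqP.
move=> e; rewrite mem_filter -dvdn_divisors //.
apply/andP/mapP => [[de en]|[f]].
  exists (e %/ d)%N; last by rewrite mulnC divnK.
  by rewrite -dvdn_divisors // dvdn_divRL // divnK.
by rewrite -dvdn_divisors // dvdn_divRL // => fn ->; rewrite dvdn_mulr // mulnC.
Qed.

Lemma perm_divisors_compl (n : nat) : (0 < n)%N ->
  perm_eq (divisors n) [seq (n %/ e)%N | e <- divisors n].
Proof.
move=> n0.
have K : {in divisors n, involutive (fun e => (n %/ e)%N)}.
  move=> e; rewrite -dvdn_divisors // => en /=.
  by rewrite divnA // mulKn.
apply: uniq_perm.
- exact: divisors_uniq.
- rewrite map_inj_in_uniq ?divisors_uniq // => x y xn yn eq_xy.
  by rewrite -(K x) // eq_xy K.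
move=> e; apply/idP/mapP => [en|[f]].
  exists (n %/ e)%N; last by rewrite K.
  by rewrite -dvdn_divisors // dvdn_div // dvdn_divisors.
by rewrite -!dvdn_divisors // => fn ->; exact: dvdn_div.
Qed.

Lemma perm_iota_dvd (e n : nat) : (e %| n)%N -> (0 < e)%N ->
  perm_eq [seq j <- index_iota 1 n.+1 | (e %| j)%N]
          [seq (e * i)%N | i <- index_iota 1 (n %/ e).+1].
Proof.
move=> en e0; apply: uniq_perm.
- exact: filter_uniq (iota_uniq _ _).
- rewrite map_inj_uniq ?iota_uniq // => x y /eqP.
  by rewrite eqn_pmul2l // => /eqP.
move=> j; rewrite mem_filter mem_index_iota ltnS.
apply/andP/mapP => [[ej /andP[j0 jn]]|[k]].
  exists (j %/ e)%N; last by rewrite mulnC divnK.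
  by rewrite mem_index_iota ltnS divn_gt0 // dvdn_leq // leq_div2r.
rewrite mem_index_iota ltnS => /andP[i0 ie] ->.
by rewrite dvdn_mulr // muln_gt0 e0 i0 mulnC -leq_divRL.
Qed.

(** If [p] divides [n], then [p ^ 2] divides [p * n]. Otherwise [p * n] has exactly one more prime
    than [n], which flips the sign, and a square [q ^ 2] with [q != p] divides [p * n] only if it
    divides [n]. *)
Lemma moebiusM_prime (p n : nat) : prime p -> (0 < n)%N ->
  moebius (p * n) = if (p %| n)%N then 0 else - moebius n.
Proof.
move=> pp n0; have p0 := prime_gt0 pp.
rewrite /moebius muln_gt0 p0 n0 /=; case pn : (p %| n)%N.
  case: ifP => // /allP sqf; have := sqf p.
  rewrite primesM // primes_prime // mem_head => /(_ isT).
  by rewrite expnS expn1 dvdn_pmul2l // pn.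
have pr : perm_eq (primes (p * n)) (p :: primes n).
  apply: uniq_perm; first exact: primes_uniq.
    by rewrite /= primes_uniq andbT mem_primes pp n0 pn.
  by move=> q; rewrite primesM // primes_prime // !inE.
rewrite (perm_all _ pr) (perm_size pr) /=.
have -> : (p ^ 2 %| p * n)%N = false by rewrite expnS expn1 dvdn_pmul2l.
rewrite /= (_ : all _ _ = all (fun q => ~~ (q ^ 2 %| n)%N) (primes n)).
  by case: ifP; rewrite ?oppr0 // exprS mulN1r.
apply: eq_in_all => q; rewrite mem_primes => /and3P[qp _ qn]; congr (~~ _).
rewrite Gauss_dvdr // coprimeXl // prime_coprime // dvdn_prime2 //.
by apply: contraFN pn => /eqP <-.
Qed.

Lemma sum_moebius (n : nat) : (0 < n)%N ->
  \sum_(e <- divisors n) moebius e = (n == 1)%:R.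
Proof.
(* For a prime [p] dividing [n], the divisors [p * e] with [e] prime to [p]
   cancel the divisors prime to [p]; the remaining ones are not squarefree. *)
move=> n0; have [->|n1] := eqVneq n 1%N.
  by rewrite (_ : divisors 1 = [:: 1%N]) // big_seq1.
set p := pdiv n; have pp : prime p by rewrite pdiv_prime // ltn_neqAle eq_sym n1.
have pn : (p %| n)%N by exact: pdiv_dvd.
have p0 := prime_gt0 pp.
have np0 : (0 < n %/ p)%N by rewrite divn_gt0 // dvdn_leq.
rewrite (bigID (fun e => p %| e)%N) /= -big_filter.
rewrite (perm_big _ (perm_divisors_dvd n0 pn)) /= big_map.
rewrite (eq_big_seq (fun e => if (p %| e)%N then 0 else - moebius e)); last first.
  move=> e; rewrite -dvdn_divisors // => en.
  by rewrite moebiusM_prime // (dvdn_gt0 np0 en).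
rewrite (bigID (fun e => p %| e)%N) /= big1 ?add0r; last by move=> e ->.
rewrite (eq_bigr (fun e => - moebius e)); last by move=> e /negbTE ->.
rewrite sumrN; apply/eqP; rewrite addrC subr_eq0; apply/eqP.
rewrite -big_filter -[RHS]big_filter.
apply: perm_big; apply: uniq_perm; try exact: filter_uniq (divisors_uniq _).
move=> e; rewrite !mem_filter -!dvdn_divisors //.
case pe : (p %| e)%N => //=.
rewrite dvdn_divRL // mulnC Gauss_dvd ?pn //.
by rewrite prime_coprime // pe.
Qed.

Lemma sum_moebius_gcd (j n : nat) : (0 < n)%N ->
  \sum_(f <- divisors n | (f %| j)%N) moebius f = (coprime j n)%:R.
Proof.
move=> n0; have g0 : (0 < gcdn j n)%N by rewrite gcdn_gt0 n0 orbT.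
rewrite /coprime -sum_moebius // -big_filter; apply: perm_big.
apply: uniq_perm; rewrite ?divisors_uniq ?filter_uniq ?divisors_uniq // => f.
by rewrite mem_filter -!dvdn_divisors // dvdn_gcd.
Qed.

(** * Roots of unity and the divisor formula for Ramanujan sums *)

Lemma expiD (R : realType) (x y : R) : expi (x + y) = expi x * expi y.
Proof.
rewrite /expi cosD sinD; apply/eqP; rewrite eq_complex /=.
by apply/andP; split; apply/eqP; ring.
Qed.

Lemma expi0 (R : realType) : expi (0 : R) = 1.
Proof. by rewrite /expi cos0 sin0. Qed.

Lemma expi_mulrn (R : realType) (x : R) (m : nat) : expi (x *+ m) = expi x ^+ m.
Proof. by elim: m => [|m IH]; rewrite ?mulr0n ?expi0 // mulrS expiD IH exprS. Qed.

Lemma expi_2pi_int (R : realType) (m : int) : expi (2 * pi * m%:~R : R) = 1.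
Proof.
have nat_case k : expi (2 * pi * k%:R : R) = 1.
  rewrite mulr_natr expi_mulrn mulrC mulr_natr /expi cos2pi sin2pi.
  by rewrite (_ : 1 +i* 0 = 1) // expr1n.
case: m => k; last rewrite NegzE.
  exact: nat_case.
apply: (mulIf (oner_neq0 R[i])); rewrite -{1}(nat_case k.+1) -expiD.
by rewrite mulrNz mulrN addNr expi0 mulr1.
Qed.

Lemma expi_neq1 (R : realType) (n : nat) (m : int) : (0 < n)%N ->
  ~~ (n%:Z %| m)%Z -> expi (2 * pi * m%:~R / n%:R : R) != 1.
Proof.
move=> n0 ndvd.
have nZ : n%:Z != 0 by rewrite eqz_nat -lt0n.
have nR : n%:R != 0 :> R by rewrite pnatr_eq0 -lt0n.
set r := (m %% n)%Z.
have r_gt0 : 0 < r.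
  by rewrite lt_neqAle modz_ge0 // andbT eq_sym; apply: contra ndvd => /eqP/dvdz_mod0P.
have r_lt : r < n%:Z by rewrite ltz_pmod.
(* Dropping full turns leaves the angle [2 * y] with [y = pi * r / n] strictly between [0] and [pi].
   Hence [sin y > 0], and [cos (2 * y) = 1 - 2 * sin y ^ 2] is less than [1]. *)
have -> : 2 * pi * m%:~R / n%:R = 2 * pi * (m %/ n)%Z%:~R + pi * r%:~R / n%:R *+ 2 :> R.
  rewrite {1}(divz_eq m n) -/r rmorphD rmorphM /= -pmulrn.
  by field.
rewrite expiD expi_2pi_int mul1r; apply/negP => /eqP [/eqP].
rewrite cos_mulr2n cos2sin2.
set y := pi * _ / _ => cosy _.
have siny : 0 < sin y.
  apply: sin_gt0_pi; rewrite /y divr_gt0 ?mulr_gt0 ?pi_gt0 ?ltr0z ?ltr0n //=.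
  rewrite ltr_pdivrMr ?ltr0n // ltr_pM2l ?pi_gt0 //.
  by rewrite pmulrn ltr_int.
have := exprn_gt0 2 siny.
move: (eqP cosy); lra.
Qed.

Lemma sum_expi (R : realType) (n : nat) (m : int) : (0 < n)%N ->
  \sum_(1 <= j < n.+1) expi (2 * pi * (j%:Z * m)%:~R / n%:R : R) =
  if (n%:Z %| m)%Z then n%:R else 0.
Proof.
move=> n0; have nR : n%:R != 0 :> R by rewrite pnatr_eq0 -lt0n.
set z := expi (2 * pi * m%:~R / n%:R : R).
have zE j : expi (2 * pi * (j%:Z * m)%:~R / n%:R : R) = z ^+ j.
  rewrite -expi_mulrn -mulr_natr; congr expi.
  by rewrite rmorphM /= -pmulrn; field.
have zn : z ^+ n = 1.
  rewrite -zE rmorphM /= -pmulrn -[RHS](expi_2pi_int R m); congr expi.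
  by field.
rewrite (eq_bigr _ (fun j _ => zE j)) big_add1 /= big_mkord.
rewrite (eq_bigr (fun j : 'I_n => z * z ^+ j)); last by move=> j _; rewrite exprS.
rewrite -mulr_sumr; case: ifP => [/dvdzP[q mq]|/negbT ndvd].
  have -> : z = 1.
    rewrite -(expi_2pi_int R q) /z; congr expi.
    by rewrite mq rmorphM /= -pmulrn; field.
  rewrite mul1r (eq_bigr (fun=> 1)); last by move=> j _; rewrite expr1n.
  by rewrite sumr_const card_ord.
(* The geometric sum times [z - 1] is [z ^+ n - 1 = 0], and [z != 1] here. *)
suff -> : \sum_(j < n) z ^+ j = 0 by rewrite mulr0.
have zn1 : z - 1 != 0 by rewrite subr_eq0 expi_neq1.
by apply: (mulfI zn1); rewrite -subrX1 zn subrr mulr0.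
Qed.

Lemma ramanujan_sumE (R : realType) (n : nat) (m : int) : (0 < n)%N ->
  ramanujan_sum R n m =
  \sum_(e <- divisors n | (e%:Z %| m)%Z) e%:R * (moebius (n %/ e))%:~R.
Proof.
move=> n0; rewrite /ramanujan_sum.
pose E j : R[i] := expi (2 * pi * (j%:Z * m)%:~R / n%:R : R).
transitivity (\sum_(1 <= j < n.+1) \sum_(f <- divisors n | (f %| j)%N)
    (moebius f)%:~R * E j).
  rewrite big_mkcond; apply: eq_bigr => j _.
  rewrite -mulr_suml -rmorph_sum /= sum_moebius_gcd //.
  by case: ifP; rewrite ?mul1r ?mul0r.
rewrite (exchange_big_dep xpredT) //=.
(* Writing [f = n / e], the multiples of [f] up to [n] are the [f * i] with [1 <= i <= e], so the
   inner sum becomes a complete exponential sum modulo [e], equal to [e] or [0]. *)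
rewrite (perm_big _ (perm_divisors_compl n0)) big_map /= [RHS]big_mkcond /=.
apply: eq_big_seq => e; rewrite -dvdn_divisors // => en.
have e0 := dvdn_gt0 n0 en.
have ne0 : (0 < n %/ e)%N by rewrite divn_gt0 // dvdn_leq.
rewrite -mulr_sumr -big_filter (perm_big _ (perm_iota_dvd _ ne0)) ?dvdn_div //.
rewrite big_map divnA // mulKn //.
rewrite (eq_bigr (fun j => expi (2 * pi * (j%:Z * m)%:~R / e%:R : R))).
  by rewrite sum_expi //; case: ifP => _; rewrite ?mulr0 // mulrC.
move=> j _; rewrite /E; congr expi.
have neR : (n %/ e)%:R != 0 :> R by rewrite pnatr_eq0 -lt0n.
have eR : e%:R != 0 :> R by rewrite pnatr_eq0 -lt0n.
rewrite -[in n%:R](divnK en) PoszM !rmorphM /= -!pmulrn.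
by field; rewrite neR eR.
Qed.

(** * Congruences and lifting of units *)

Lemma eqz_modP (n a b : int) : (a = b %[mod n])%Z <-> (n %| a - b)%Z.
Proof. by rewrite -eqz_mod_dvd; split => [/eqP|/eqP]. Qed.

Lemma coprimez_congr (n a b : int) :
  (n %| a - b)%Z -> coprimez a n = coprimez b n.
Proof. by move=> /eqz_modP ab; rewrite /coprimez -gcdz_modl ab gcdz_modl. Qed.

Lemma coprimez_dvd (a m n : int) : (m %| n)%Z -> coprimez a n -> coprimez a m.
Proof. by rewrite dvdzE !coprimezE; exact: coprime_dvdr. Qed.

Lemma coprimez_inv (a n : int) : coprimez a n ->
  exists2 a', coprimez a' n & (n %| a' * a - 1)%Z.
Proof.
move=> /coprimezP[[u v] /= uv]; exists u.
  by apply/coprimezP; exists (a, v) => /=; rewrite mulrC.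
by apply/dvdzP; exists (- v); rewrite -uv; ring.
Qed.

Lemma coprimez_lift (a : int) (e n : nat) : (0 < n)%N -> (e %| n)%N ->
  coprimez a e -> exists2 b, coprimez b n & (e%:Z %| b - a)%Z.
Proof.
move=> n0 en ae; have e0 := dvdn_gt0 n0 en.
(* Only for [e = 1] can [a] be [0]; the comparison of prime supports below needs [a] nonzero. *)
have [e1|e_neq1] := eqVneq e 1%N.
  by exists 1; rewrite ?coprimezE ?coprime1n // e1 dvd1z.
have a0 : (0 < `|a|)%N.
  rewrite lt0n absz_eq0; apply: contra e_neq1 => /eqP a0; move: ae.
  by rewrite a0 coprimezE /coprime gcd0n.
(* Chinese remainders: [a] modulo the part of [n] supported on the primes of
   [e], and [1] modulo the rest. *)
pose m1 := (n`_(\pi(e)))%N; pose m2 := (n`_(\pi(e)^'))%N.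
have m12 : coprimez m1 m2 by rewrite coprimezE coprime_partC.
have am1 : coprimez a m1.
  rewrite coprimezE coprime_sym; apply: (@pnat_coprime \pi(e)).
    exact: part_pnat.
  by rewrite -coprime_pi' // coprime_sym -(absz_nat e) -coprimezE.
have em1 : (e %| m1)%N by rewrite -(part_pnat_id (pnat_pi e0)) partn_dvd.
have /eqz_modP b1 := zchinese_modl m12 a 1.
have /eqz_modP b2 := zchinese_modr m12 a 1.
exists (zchinese m1 m2 a 1); last exact: dvdz_trans b1.
rewrite -(partnC \pi(e) n0) PoszM coprimezMr (coprimez_congr b1) am1.
by rewrite (coprimez_congr b2) coprimezE coprime1n.
Qed.

(** * Sums over residue systems and equidistribution of units *)

Lemma sum_periodic_shift (V : nmodType) (n : nat) (F : int -> V) :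
  (0 < n)%N -> (forall a b, (n%:Z %| a - b)%Z -> F a = F b) ->
  \sum_(1 <= k < n.+1) F k%:Z = \sum_(k < n) F k%:Z.
Proof.
move=> n_gt0 F_periodic.
rewrite -(big_mkord xpredT (fun k => F k%:Z)) big_nat_recr // [RHS]big_ltn //=.
(* The two ranges differ only in the terms at [n] and at [0], which agree by periodicity. *)
by rewrite addrC; congr (_ + _); apply: F_periodic; rewrite subr0 dvdzz.
Qed.

(** Multiplication by a unit permutes the residues modulo [n]; [h] is this permutation on the
    representatives below [n]. *)
Lemma sum_periodic_mul (V : nmodType) (n : nat) (u : int) (F : int -> V) :
  (0 < n)%N -> (forall a b, (n%:Z %| a - b)%Z -> F a = F b) ->
  coprimez u n ->
  \sum_(k < n) F (u * k%:Z) = \sum_(k < n) F k%:Z.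
Proof.
move=> n_gt0 F_periodic un; have nZ : n%:Z != 0 by rewrite eqz_nat -lt0n.
have h_subproof (k : 'I_n) : (`|(u * k%:Z %% n)%Z| < n)%N.
  by rewrite -ltz_nat gez0_abs ?modz_ge0 // ltz_pmod.
pose h k := Ordinal (h_subproof k).
have hE k : (h k)%:Z = (u * k%:Z %% n)%Z by rewrite /= gez0_abs ?modz_ge0.
have h_inj : injective h.
  move=> i j hij; have : (u * i%:Z = u * j%:Z %[mod n])%Z by rewrite -!hE hij.
  move=> /eqz_modP; rewrite -mulrBr Gauss_dvdzr 1?coprimez_sym //.
  move=> /eqz_modP; rewrite !modz_small ?ltz_nat ?ltn_ord // => -[ij].
  exact: val_inj.
rewrite [RHS](reindex_inj h_inj); apply: eq_bigr => k _.
by apply: F_periodic; rewrite hE -eqz_mod_dvd modz_mod.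
Qed.

Lemma dvdz_sub_congr (e a b s : int) :
  (e %| a - b)%Z -> (e %| a - s)%Z = (e %| b - s)%Z.
Proof.
move=> ab; have -> : a - s = (a - b) + (b - s) by ring.
exact: rpredDl.
Qed.

Lemma totient_sum (C : pzRingType) (n : nat) :
  \sum_(k < n | coprimez k n) 1 = (totient n)%:R :> C.
Proof.
rewrite totient_count_coprime big_mkord natr_sum big_mkcond.
by apply: eq_bigr => k _; rewrite coprimezE coprime_sym /=; case: ifP.
Qed.

(** All classes prime to [e] contain equally many units modulo [n], because multiplication by a
    suitable unit carries one class to another. Summing over these [totient e] classes counts every
    unit modulo [n] once. *)
Lemma sum_units_residue (C : pzRingType) (e n : nat) (s : int) :
  (0 < n)%N -> (e %| n)%N -> coprimez s e ->
  (totient e)%:R * \sum_(k < n | coprimez k n && (e%:Z %| k%:Z - s)%Z) 1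
  = (totient n)%:R :> C.
Proof.
move=> n0 en se; have e0 := dvdn_gt0 n0 en; have enZ : (e%:Z %| n%:Z)%Z by [].
have eZ : e%:Z != 0 by rewrite eqz_nat -lt0n.
pose N (t : int) := \sum_(k < n | coprimez k n && (e%:Z %| k%:Z - t)%Z) (1 : C).
have N_eq (j : int) : coprimez j e -> N j = N s.
  move=> je; have [j' j'e j'j] := coprimez_inv je.
  (* The factor [j' * s] sends the class of [j] to that of [s], but it is prime only to [e]; its
     lift [u] also permutes the units modulo [n]. *)
  have := coprimez_lift (a := j' * s) n0 en.
  rewrite coprimezMl j'e se => /(_ isT)[u un us].
  pose F x : C := if coprimez x n && (e%:Z %| x - s)%Z then 1 else 0.
  rewrite /N !(big_mkcond (fun k : 'I_n => _ && _)) /=.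
  have Fper a b : (n%:Z %| a - b)%Z -> F a = F b.
    move=> ab; rewrite /F (coprimez_congr ab).
    by rewrite (dvdz_sub_congr _ (dvdz_trans enZ ab)).
  rewrite -[RHS](sum_periodic_mul n0 Fper un); apply: eq_bigr => k _.
  rewrite /F coprimezMl un /=; congr (if _ && _ then _ else _).
  have ue : coprimez e u by rewrite coprimez_sym (coprimez_dvd enZ).
  rewrite -(Gauss_dvdzr _ ue).
  have -> : u * k%:Z - s = u * (k%:Z - j) + (u * j - s) by ring.
  symmetry; apply: rpredDr.
  have -> : u * j - s = (u - j' * s) * j + (j' * j - 1) * s by ring.
  by apply: rpredD; exact: dvdz_mulr.
rewrite -[RHS]totient_sum -[(totient e)%:R]totient_sum mulr_suml.
rewrite -/(N s) (eq_bigr (fun j : 'I_e => N j%:Z)); last first.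
  by move=> j je; rewrite mul1r N_eq.
rewrite (exchange_big_dep (fun k : 'I_n => coprimez k%:Z n)) /=; last first.
  by move=> j k _ /andP[].
apply: eq_bigr => k kn.
(* The only class containing [k] is that of its remainder modulo [e]. *)
have r_subproof : (`|(k%:Z %% e)%Z| < e)%N.
  by rewrite -ltz_nat gez0_abs ?modz_ge0 // ltz_pmod.
rewrite (big_pred1 (Ordinal r_subproof)) // => j /=.
rewrite kn /=; apply/andP/eqP => [[_]|->] /=.
  move=> /eqz_modP; rewrite [RHS]modz_small ?ltz_nat ?ltn_ord //.
  by move=> kj; apply: val_inj; rewrite /= kj.
have rE : (e%:Z %| k%:Z - `|(k%:Z %% e)%Z|%N%:Z)%Z.
  by rewrite gez0_abs ?modz_ge0 // -eqz_mod_dvd modz_mod.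
by rewrite -(coprimez_congr rE) (coprimez_dvd enZ).
Qed.

(** * Induced moduli and character sums over residue classes *)

Lemma induced_modulus_gcd (R : realType) (n d e : nat) (chi : int -> R[i]) :
  (0 < n)%N -> dirichlet_character n chi ->
  induced_modulus n chi d -> induced_modulus n chi e ->
  induced_modulus n chi (gcdn d e).
Proof.
move=> n0 [chi_mod chiM _] [dn chid] [en chie].
split=> [|a an /eqz_modP]; first exact: dvdn_trans (dvdn_gcdl _ _) dn.
case/dvdzP=> t at1.
have [u [v uv]] : exists u v : int, u * d + v * e = gcdn d e.
  by have [u v uv _] := egcdzP d e; exists u, v.
(* [b0] solves [b0 = a] mod [d] and [b0 = 1] mod [e]. *)
pose b0 : int := 1 + v * e * t.
have b0d : (d%:Z %| b0 - a)%Z.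
  apply/dvdzP; exists (- u * t); rewrite /b0.
  have -> : a = 1 + t * (u * d + v * e) by rewrite uv -at1; ring.
  by ring.
have b0e : (e%:Z %| b0 - 1)%Z.
  by rewrite /b0 addrC addKr -mulrA dvdz_mull // dvdz_mulr.
have b0_cop : coprimez b0 (lcmn d e).
  have : coprimez b0 (d * e)%N.
    rewrite PoszM coprimezMr (coprimez_congr b0d) (coprimez_congr b0e).
    by rewrite (coprimez_dvd _ an) // coprimezE coprime1n.
  by apply: coprimez_dvd; rewrite dvdzE !absz_nat dvdn_lcm dvdn_mulr // dvdn_mull.
have lcm_n : (lcmn d e %| n)%N by rewrite dvdn_lcm dn en.
(* Since [b0] is prime only to the lcm, it is lifted to a unit [b] modulo [n]. Then [b = 1] mod [e]
   gives [chi b = 1], and [a' * b = 1] mod [d] gives [chi (a' * b) = 1]. So [chi a' = 1], and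
   [chi a = 1] follows. *)
have [b bn bb0] := coprimez_lift n0 lcm_n b0_cop.
have [a' a'n a'a] := coprimez_inv an.
have chi_b : chi b = 1.
  apply: chie => //; apply/eqz_modP.
  by rewrite (dvdz_sub_congr 1 (b := b0)) //; apply: dvdz_trans bb0;
    exact: dvdn_lcmr.
have chi_1 : chi 1 = 1 by apply: chid => //; rewrite coprimezE coprime1n.
have chi_a'b : chi (a' * b) = 1.
  apply: chid; first by rewrite coprimezMl a'n bn.
  apply/eqz_modP.
  have -> : a' * b - 1 = a' * (b - b0) + a' * (b0 - a) + (a' * a - 1) by ring.
  apply: rpredD; last exact: dvdz_trans a'a.
  apply: rpredD; apply: dvdz_mull => //; apply: dvdz_trans bb0.
  exact: dvdn_lcml.
move: chi_a'b; rewrite chiM chi_b mulr1 => chi_a'.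
have /eqz_modP/chi_mod := a'a.
by rewrite chiM chi_a' mul1r chi_1.
Qed.

Lemma sum_character_residue_neq0 (R : realType) (n e : nat)
    (chi : int -> R[i]) (s : int) :
  (0 < n)%N -> (e %| n)%N -> dirichlet_character n chi ->
  \sum_(k < n | (e%:Z %| k%:Z - s)%Z) chi k%:Z != 0 -> induced_modulus n chi e.
Proof.
move=> n0 en [chi_mod chiM _]; have enZ : (e%:Z %| n%:Z)%Z by [].
rewrite big_mkcond => S_neq0; split=> // a an /eqz_modP a1.
pose F x := if (e%:Z %| x - s)%Z then chi x else 0.
have Fper x y : (n%:Z %| x - y)%Z -> F x = F y.
  move=> xy; rewrite /F (dvdz_sub_congr _ (dvdz_trans enZ xy)).
  by rewrite (chi_mod x y) //; apply/eqz_modP.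
apply: (mulIf S_neq0); rewrite mul1r -[RHS](sum_periodic_mul n0 Fper an).
rewrite mulr_sumr; apply: eq_bigr => k _; rewrite /F.
rewrite (@dvdz_sub_congr e (a * k%:Z) k%:Z); first by case: ifP; rewrite ?mulr0.
by rewrite (_ : _ - _ = (a - 1) * k%:Z) ?dvdz_mulr //; ring.
Qed.

Lemma sum_character_residue (R : realType) (n d e : nat)
    (chi chis : int -> R[i]) (s : int) :
  (0 < n)%N -> (e %| n)%N -> dirichlet_character n chi ->
  conductor n chi d -> induces d n chis chi ->
  \sum_(k < n | (e%:Z %| k%:Z - s)%Z) chi k%:Z =
  if (d %| e)%N && coprimez s e then
    chis s * (totient n)%:R / (totient e)%:R
  else 0.
Proof.
move=> n0 en chiP [chi_d d_min] [[[chis_mod _ _] _] chiE].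
have e0 := dvdn_gt0 n0 en; have enZ : (e%:Z %| n%:Z)%Z by [].
case: ifP => [/andP[de se]|/negbT].
  have te : (totient e)%:R != 0 :> R[i].
    by rewrite pnatr_eq0 -lt0n totient_gt0.
  rewrite -(sum_units_residue R[i] n0 en se) [chis s * _]mulrCA mulrAC divff // mul1r.
  rewrite mulr_sumr [RHS]big_mkcondl.
  apply: eq_bigr => k ks; rewrite chiE mulr1; case: ifP => // _.
  apply: chis_mod; apply/eqz_modP; exact: dvdz_trans ks.
rewrite negb_and => /orP[ndvd|nse].
  apply/eqP; apply: contraNT ndvd => S_neq0.
  have chi_e := sum_character_residue_neq0 n0 en chiP S_neq0.
  (* The gcd of [d] and [e] is an induced modulus, so minimality of [d] forces it to equal [d]. *)
  have := d_min _ (induced_modulus_gcd n0 chiP chi_d chi_e).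
  have d0 := dvdn_gt0 n0 chi_d.1.
  have := dvdn_leq d0 (dvdn_gcdl d e) => g_le d_le.
  by have /eqP <- : gcdn d e == d; [rewrite eqn_leq g_le | exact: dvdn_gcdr].
(* A [k] congruent to [s] mod [e] shares with [e], hence with [n], a common factor, so
   [chi k = 0]. *)
rewrite big1 // => k ks; rewrite chiE; case: ifP => // kn.
by case/negP: nse; rewrite -(coprimez_congr ks) (coprimez_dvd enZ).
Qed.

(** * Assembly of the formula *)

Theorem corollary2p6 (R : realType) (n d : nat) (chi chis : int -> R[i])
    (s : int)
    (n_gt0 : (0 < n)%N) (d_gt0 : (0 < d)%N) (dvd_dn : (d %| n)%N)
    (chiP : dirichlet_character n chi) (cond_chi : conductor n chi d)
    (chisP : induces d n chis chi) :
  \sum_(1 <= k < n.+1) ramanujan_sum R n (k%:Z - s) * chi k%:Z =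
  d%:R * (totient n)%:R * chis s *
  \sum_(delta <- divisors (n %/ d) | coprimez delta%:Z s)
    delta%:R * (moebius (n %/ (delta * d)))%:~R / (totient (delta * d))%:R.
Proof.
have [chi_mod _ _] := chiP.
pose G e : R[i] := e%:R * (moebius (n %/ e))%:~R.
pose F e k := if (e%:Z %| k - s)%Z then chi k else 0.
transitivity (\sum_(e <- divisors n) G e * \sum_(1 <= k < n.+1) F e k%:Z).
  under [RHS]eq_bigr => e _ do rewrite mulr_sumr.
  rewrite exchange_big /=; apply: eq_bigr => k _.
  rewrite ramanujan_sumE // mulr_suml big_mkcond /=; apply: eq_bigr => e _.
  by rewrite /F; case: ifP; rewrite ?mulr0.
transitivity (\sum_(e <- divisors n | (d %| e)%N)
    G e * if coprimez s e then chis s * (totient n)%:R / (totient e)%:R else 0).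
  rewrite [RHS]big_mkcond; apply: eq_big_seq => e.
  rewrite -dvdn_divisors // => en; have enZ : (e%:Z %| n%:Z)%Z by [].
  rewrite sum_periodic_shift //.
    rewrite -big_mkcond (sum_character_residue s n_gt0 en chiP cond_chi chisP).
    by case: (d %| e)%N; rewrite ?mulr0.
  move=> a b ab; rewrite /F (dvdz_sub_congr _ (dvdz_trans enZ ab)).
  by rewrite (chi_mod a b) //; apply/eqz_modP.
rewrite -big_filter (perm_big _ (perm_divisors_dvd n_gt0 dvd_dn)) big_map.
have [[[_ _ chis_neq0] _] _] := chisP.
rewrite [in RHS]big_mkcond mulr_sumr; apply: eq_bigr => delta _.
(* Being prime to [d * delta] splits into two conditions on [s]. The right-hand side tests only the
   one on [delta]; the one on [d] is carried by [chis s], which vanishes when [s] is not prime to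
   [d]. *)
rewrite PoszM coprimezMr [coprimez delta s]coprimez_sym mulnC.
case: (boolP (coprimez s d)) => sd /=; last first.
  have -> : chis s = 0 by apply/eqP; apply: contraNT sd => /chis_neq0.
  by rewrite !(mulr0, mul0r).
case: ifP => _; last by rewrite !mulr0.
by rewrite /G natrM; ring.
Qed.
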